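(* There are four $4$-dimensional Levi decomposable subalgebras of $\mathfrak{so}(4,\mathbb{C})$, up to inner automorphism. They are $$(A_1\oplus J)^1=\langle x_1,y_1,h_1\rangle\oplus\langle h_2\rangle,\qquad (A_1\oplus J)^2=\langle x_1,y_1,h_1\rangle\oplus\langle x_2\rangle,$$ $$(A_1\oplus J)^3=\langle x_2,y_2,h_2\rangle\oplus\langle h_1\rangle,\qquad (A_1\oplus J)^4=\langle x_2,y_2,h_2\rangle\oplus\langle x_1\rangle.$$ That is, every $4$-dimensional Levi decomposable subalgebra of $\mathfrak{so}(4,\mathbb{C})$ is equivalent to exactly one of these four.
   Context: A Levi decomposable algebra is a finite-dimensional Lie algebra with a nontrivial decomposition as a semidirect sum of a semisimple Lie algebra with a solvable ideal (both the semisimple part and the solvable part nonzero). $\mathfrak{so}(4,\mathbb{C})\cong\mathfrak{sl}(2,\mathbb{C})\oplus\mathfrak{sl}(2,\mathbb{C})$ is realized as the Lie algebra of $4\times4$ complex block diagonal matrices with two traceless $2\times 2$ diagonal blocks. With $E_{ij}$ the $4\times 4$ matrix units, its Chevalley basis is $x_1=E_{12}$, $y_1=E_{21}$, $h_1=E_{11}-E_{22}$, $x_2=E_{34}$, $y_2=E_{43}$, $h_2=E_{33}-E_{44}$. The notation $\langle\cdots\rangle$ denotes complex linear span. The inner automorphisms of $\mathfrak{so}(4,\mathbb{C})$ are the maps $X\mapsto AXA^{-1}$ with $A\in SL(2,\mathbb{C})\times SL(2,\mathbb{C})$ (block diagonal $4\times4$ matrices with both $2\times2$ blocks of determinant $1$).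 Two subalgebras $S,S'$ are equivalent (up to inner automorphism), written $S\sim S'$, if $\psi(S)=S'$ for some inner automorphism $\psi$ of $\mathfrak{so}(4,\mathbb{C})$. ($A_1$ denotes the type of $\mathfrak{sl}(2,\mathbb{C})$ and $J$ the $1$-dimensional Lie algebra.) *)

(* Defs.v *)
From HB Require Import structures.
From mathcomp Require Import all_boot all_order all_algebra.
From mathcomp Require Import reals.
From mathcomp Require Import complex.

Set Implicit Arguments.
Unset Strict Implicit.
Unset Printing Implicit Defensive.

Import GRing.Theory.
Local Open Scope ring_scope.

Section MatrixLieAlgebras.
Variables (F : fieldType) (n : nat).
Implicit Types (A B X Y : 'M[F]_n) (I L S U V W : {vspace 'M[F]_n}).

Definition lie_br X Y : 'M[F]_n := X *m Y - Y *m X.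

(* [U, V], the span of all brackets of an element of U with one of V; brackets
   of basis vectors suffice by bilinearity (mem_lie_brv). *)
Definition lie_brv U V : {vspace 'M[F]_n} :=
  <<[seq lie_br X Y | X <- vbasis U, Y <- vbasis V]>>%VS.

Lemma mem_lie_brv U V X Y :
  X \in U -> Y \in V -> lie_br X Y \in lie_brv U V.
Proof.
move=> XU YV.
rewrite (coord_vbasis XU) /lie_br mulmx_suml mulmx_sumr -sumrB.
apply: memv_suml => i _.
rewrite (coord_vbasis YV) mulmx_sumr mulmx_suml -sumrB.
apply: memv_suml => j _.
rewrite -!scalemxAl -!scalemxAr !scalerA.
rewrite [_ * coord _ i X]mulrC -scalerBr.
apply: memvZ; apply: memv_span; apply: allpairs_f; apply: mem_nth;
  by rewrite size_tuple ltn_ord.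
Qed.

Definition lie_subalgebra L : Prop :=
  forall X Y, X \in L -> Y \in L -> lie_br X Y \in L.

Definition lie_ideal I L : Prop :=
  (I <= L)%VS /\ (forall X Y, X \in L -> Y \in I -> lie_br X Y \in I).

Definition lie_derived_series L (k : nat) : {vspace 'M[F]_n} :=
  iter k (fun U => lie_brv U U) L.

Definition lie_solvable L : Prop :=
  exists k, lie_derived_series L k = 0%VS.

(* The zero algebra is semisimple here; nonvanishing is required separately in
   levi_decomposable. *)
Definition lie_semisimple L : Prop :=
  lie_subalgebra L /\ (forall I, lie_ideal I L -> lie_solvable I -> I = 0%VS).

Definition lie_semidirect_sum L S I : Prop :=
  [/\ lie_subalgebra S, lie_ideal I L, (S + I)%VS = L & (S :&: I)%VS = 0%VS].

Definition lie_direct_sum L U V : Prop :=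
  [/\ lie_ideal U L, lie_ideal V L, (U + V)%VS = L & (U :&: V)%VS = 0%VS].

Definition levi_decomposable L : Prop :=
  lie_subalgebra L /\
  exists S I, [/\ lie_semidirect_sum L S I, lie_semisimple S, lie_solvable I,
                  S <> 0%VS & I <> 0%VS].

End MatrixLieAlgebras.

Section So4.
Variable F : fieldType.

Definition so4 : {pred 'M[F]_(2 + 2)} :=
  [pred X | [&& ursubmx X == 0, dlsubmx X == 0,
                \tr (ulsubmx X) == 0 & \tr (drsubmx X) == 0]].

(* Matrix units, with rows and columns numbered from 1 to 4. *)
Definition E (i j : nat) : 'M[F]_(2 + 2) :=
  delta_mx (@inord 3 i.-1) (@inord 3 j.-1).

Definition x1 : 'M[F]_(2 + 2) := E 1 2.
Definition y1 : 'M[F]_(2 + 2) := E 2 1.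
Definition h1 : 'M[F]_(2 + 2) := E 1 1 - E 2 2.
Definition x2 : 'M[F]_(2 + 2) := E 3 4.
Definition y2 : 'M[F]_(2 + 2) := E 4 3.
Definition h2 : 'M[F]_(2 + 2) := E 3 3 - E 4 4.

Definition SL2xSL2 (A : 'M[F]_(2 + 2)) : Prop :=
  exists P Q : 'M[F]_2, [/\ \det P = 1, \det Q = 1 & A = block_mx P 0 0 Q].

Definition conj_by (A : 'M[F]_(2 + 2)) : 'End('M[F]_(2 + 2)) :=
  linfun (mulmxr (invmx A) \o mulmx A).

Lemma conj_byE A X : conj_by A X = A *m X *m invmx A.
Proof. by rewrite lfunE. Qed.

Definition inner_equiv (S S' : {vspace 'M[F]_(2 + 2)}) : Prop :=
  exists2 A, SL2xSL2 A & (conj_by A @: S)%VS = S'.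

Definition so4_subalgebra (L : {vspace 'M[F]_(2 + 2)}) : Prop :=
  {subset L <= so4} /\ lie_subalgebra L.

Definition levi_decomposable_so4 (d : nat) (L : {vspace 'M[F]_(2 + 2)}) : Prop :=
  [/\ so4_subalgebra L, levi_decomposable L & \dim L = d].

Definition A1J_summands :
    4.-tuple ({vspace 'M[F]_(2 + 2)} * {vspace 'M[F]_(2 + 2)}) :=
  [tuple (<<[:: x1; y1; h1]>>%VS, <[h2]>%VS);
         (<<[:: x1; y1; h1]>>%VS, <[x2]>%VS);
         (<<[:: x2; y2; h2]>>%VS, <[h1]>%VS);
         (<<[:: x2; y2; h2]>>%VS, <[x1]>%VS)].

Definition A1 (i : 'I_4) : {vspace 'M[F]_(2 + 2)} := (tnth A1J_summands i).1.
Definition J (i : 'I_4) : {vspace 'M[F]_(2 + 2)} := (tnth A1J_summands i).2.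

(* (A_1 (+) J)^(i+1) *)
Definition A1J (i : 'I_4) : {vspace 'M[F]_(2 + 2)} := (A1 i + J i)%VS.

End So4.

(* Main.v *)
(* A solvable algebra has no nonzero semisimple subalgebra, and a subalgebra of
   so(4) whose two projections to sl(2) are at most two-dimensional is solvable.
   So some projection of [L] is all of sl(2); the intersection of [L] with that
   factor is nonzero for dimension reasons and stable under sl(2), hence it is
   the whole factor. Thus [L] is one factor plus a line in the other, and the
   line is conjugate to the one spanned by h or by x, according to whether its
   generator is semisimple or nilpotent. The four algebras are told apart by
   which factors they meet in nonzero semisimple or nilpotent elements. *)

Require Import Defs.
From HB Require Import structures.
From mathcomp Require Import all_boot all_order all_algebra.
From mathcomp Require Import reals.
From mathcomp Require Import complex.
From mathcomp Require Import ring.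

Set Implicit Arguments.
Unset Strict Implicit.
Unset Printing Implicit Defensive.

Import GRing.Theory Num.Theory.

Local Open Scope ring_scope.

(** * Two-by-two matrices in coordinates, and sl(2) *)

Section Mx2.
Variable F : fieldType.
Implicit Types (a b c d : F) (P Q : 'M[F]_2).

Definition mx2 a b c d : 'M[F]_2 :=
  \matrix_(i, j) if i == 0 then if j == 0 then a else b
                 else if j == 0 then c else d.

Lemma mx2P P Q : [/\ P 0 0 = Q 0 0, P 0 1 = Q 0 1, P 1 0 = Q 1 0 & P 1 1 = Q 1 1] ->
  P = Q.
Proof.
have ord2 (i : 'I_2) : i = 0 \/ i = 1.
  by case: i => [[|[|//]] lti]; [left | right]; apply: val_inj.
move=> [E00 E01 E10 E11]; apply/matrixP => i j.
by case: (ord2 i) => ->; case: (ord2 j) => ->.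
Qed.

Lemma mx2_eta P : P = mx2 (P 0 0) (P 0 1) (P 1 0) (P 1 1).
Proof. by apply: mx2P; rewrite !mxE. Qed.

Lemma mul_mx2 a b c d a' b' c' d' :
  mx2 a b c d *m mx2 a' b' c' d' =
  mx2 (a * a' + b * c') (a * b' + b * d') (c * a' + d * c') (c * b' + d * d').
Proof. by apply: mx2P; rewrite !mxE !big_ord_recl !big_ord0 !mxE /= !addr0. Qed.

Lemma add_mx2 a b c d a' b' c' d' :
  mx2 a b c d + mx2 a' b' c' d' = mx2 (a + a') (b + b') (c + c') (d + d').
Proof. by apply: mx2P; rewrite !mxE. Qed.

Lemma opp_mx2 a b c d : - mx2 a b c d = mx2 (- a) (- b) (- c) (- d).
Proof. by apply: mx2P; rewrite !mxE. Qed.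

Lemma scale_mx2 k a b c d : k *: mx2 a b c d = mx2 (k * a) (k * b) (k * c) (k * d).
Proof. by apply: mx2P; rewrite !mxE. Qed.

Lemma eq_mx2 a b c d a' b' c' d' : mx2 a b c d = mx2 a' b' c' d' ->
  [/\ a = a', b = b', c = c' & d = d'].
Proof.
by move/matrixP=> E; move: (E 0 0) (E 0 1) (E 1 0) (E 1 1); rewrite !mxE.
Qed.

Lemma mx2_0 : mx2 0 0 0 0 = 0.
Proof. by apply: mx2P; rewrite !mxE. Qed.

Lemma mxtrace_mx2 a b c d : \tr (mx2 a b c d) = a + d.
Proof. by rewrite /mxtrace !big_ord_recl big_ord0 !mxE /= addr0. Qed.

Lemma det_mx2 a b c d : \det (mx2 a b c d) = a * d - b * c.
Proof.
rewrite (expand_det_row _ 0) !big_ord_recl big_ord0 /cofactor !det_mx11 !mxE /=.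
by rewrite expr0 expr1; ring.
Qed.

Definition sl_e := mx2 0 1 0 0.
Definition sl_f := mx2 0 0 1 0.
Definition sl_h := mx2 1 0 0 (-1).
Definition sl2 : {vspace 'M[F]_2} := <<[:: sl_e; sl_f; sl_h]>>%VS.

Lemma sl2P P : reflect (exists a b c, P = mx2 a b c (- a)) (P \in sl2).
Proof.
apply: (iffP idP) => [|[a [b [c ->]]]].
  rewrite /sl2 !span_cons span_nil addv0 => /memv_addP[_ /vlineP[b ->]].
  case=> _ /memv_addP[_ /vlineP[c ->] [_ /vlineP[a ->] ->]] ->.
  exists a, b, c; rewrite !scale_mx2 !add_mx2.
  by congr mx2; ring.
have ->: mx2 a b c (- a) = b *: sl_e + c *: sl_f + a *: sl_h.
  by rewrite !scale_mx2 !add_mx2; congr mx2; ring.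
by rewrite !memvD // memvZ // memv_span // !inE eqxx ?orbT.
Qed.

Lemma mem_sl2 P : (P \in sl2) = (\tr P == 0).
Proof.
apply/sl2P/eqP => [[a [b [c ->]]]|].
  by rewrite mxtrace_mx2 subrr.
rewrite (mx2_eta P) mxtrace_mx2 => /eqP; rewrite addrC addr_eq0 => /eqP ->.
by exists (P 0 0), (P 0 1), (P 1 0).
Qed.

Lemma dim_sl2 : \dim sl2 = 3%N.
Proof.
apply/eqP/(@freeP _ _ _ [tuple sl_e; sl_f; sl_h]) => k.
rewrite !big_ord_recl big_ord0 /= addr0 !scale_mx2 !add_mx2 -mx2_0.
move=> /eq_mx2[]; rewrite !mulr0 !mulr1 ?add0r ?addr0 => k2 k0 k1 _ i.
case: i => [[|[|[|//]]] lti]; [rewrite -[RHS]k0 | rewrite -[RHS]k1 | rewrite -[RHS]k2];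
  by congr k; apply: val_inj.
Qed.

Lemma lie_br_sl2 P Q : lie_br P Q \in sl2.
Proof. by rewrite mem_sl2 /lie_br raddfB /= mxtrace_mulC subrr. Qed.

End Mx2.

(** * Bilinearity of the bracket and algebras of small dimension *)

Section LieBracket.
Variables (F : fieldType) (n : nat).
Implicit Types (X Y : 'M[F]_n) (U V W : {vspace 'M[F]_n}).

Lemma lie_brxx X : lie_br X X = 0.
Proof. exact: subrr. Qed.

Lemma lie_brC X Y : lie_br Y X = - lie_br X Y.
Proof. by rewrite /lie_br opprB. Qed.

Lemma lie_brDl X X' Y : lie_br (X + X') Y = lie_br X Y + lie_br X' Y.
Proof. by rewrite /lie_br mulmxDl mulmxDr opprD addrACA. Qed.

Lemma lie_brZl k X Y : lie_br (k *: X) Y = k *: lie_br X Y.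
Proof. by rewrite /lie_br -scalemxAl -scalemxAr scalerBr. Qed.

Lemma lie_brDr X Y Y' : lie_br X (Y + Y') = lie_br X Y + lie_br X Y'.
Proof. by rewrite lie_brC lie_brDl opprD -!lie_brC. Qed.

Lemma lie_brZr k X Y : lie_br X (k *: Y) = k *: lie_br X Y.
Proof. by rewrite lie_brC lie_brZl -scalerN -lie_brC. Qed.

Lemma lie_br0 X : lie_br X 0 = 0.
Proof. by rewrite /lie_br mulmx0 mul0mx subrr. Qed.

Lemma lie_brv_subP U V W :
  (forall X Y, X \in U -> Y \in V -> lie_br X Y \in W) -> (lie_brv U V <= W)%VS.
Proof.
by move=> UVW; apply/span_subvP => _ /allpairsP[u [u1 u2 ->]]; apply: UVW; apply: vbasis_mem.
Qed.

Lemma lie_solvable_line X : lie_solvable <[X]>.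
Proof.
exists 1%N; apply/eqP; rewrite -subv0; apply: lie_brv_subP => _ _ /vlineP[k ->] /vlineP[k' ->].
by rewrite lie_brZl lie_brZr lie_brxx !scaler0 mem0v.
Qed.

(** The bracket is alternating, so on two generators all brackets are multiples of the single
    bracket of these generators. *)
Lemma dim2_lie_brv_sub_line U : (\dim U <= 2)%N ->
  exists Z, forall X Y, X \in U -> Y \in U -> lie_br X Y \in <[Z]>%VS.
Proof.
move=> dimU.
have [Z1 [Z2 UZ]] : exists Z1 Z2, (U <= <[Z1]> + <[Z2]>)%VS.
  (* When [U] has dimension below 2, the missing basis vectors are the default value 0. *)
  exists (vbasis U)`_0, (vbasis U)`_1.
  rewrite -{1}(span_basis (vbasisP U)) -span_seq1 -[X in (_ + X)%VS]span_seq1 -span_cat.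
  apply: sub_span => X /tnthP[[i ltiU] ->].
  rewrite (tnth_nth 0) /=; case: i ltiU => [|[|i]] ltiU; rewrite !inE ?eqxx ?orbT //.
  by move: (leq_trans ltiU dimU).
exists (lie_br Z1 Z2) => X Y /(subvP UZ)/memv_addP[_ /vlineP[k1 ->] [_ /vlineP[k2 ->] ->]].
move=> /(subvP UZ)/memv_addP[_ /vlineP[k3 ->] [_ /vlineP[k4 ->] ->]].
rewrite !(lie_brDl, lie_brDr, lie_brZl, lie_brZr) !lie_brxx (lie_brC Z1 Z2).
by rewrite !scaler0 add0r addr0 memvD // !memvZ // ?memvN memv_line.
Qed.

End LieBracket.

(** * Simplicity of sl(2) and conjugacy of its elements *)

Section Sl2.
Variable F : fieldType.
Hypothesis two_neq0 : 2%:R != 0 :> F.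
Implicit Types P Q : 'M[F]_2.

(** Write [P] as ah + be + cf. Applying ad e twice gives -2ce, and applying ad f twice gives -2bf;
    if b and c both vanish, [P] is a multiple of h. So [N] contains e, f or h, and each of these
    generates the other two. [N] is only assumed stable under sl(2), not contained in it, so that
    preimages of subspaces can be used for [N]. *)
Lemma sl2_simple (N : {vspace 'M[F]_2}) P :
    (forall X Y, X \in sl2 F -> Y \in N -> lie_br X Y \in N) ->
  P \in sl2 F -> P \in N -> P != 0 -> (sl2 F <= N)%VS.
Proof.
move=> adN /sl2P[a [b [c ->]]] PN Pn0.
have [ees fs hs] : [/\ sl_e F \in sl2 F, sl_f F \in sl2 F & sl_h F \in sl2 F].
  by rewrite !mem_sl2 !mxtrace_mx2 !addr0 subrr !eqxx.
have memN k X Y : k != 0 -> k *: X = Y -> Y \in N -> X \in N.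
  by move=> k0 <- /(memvZ k^-1); rewrite scalerA mulVf ?scale1r.
have brE := (mul_mx2, opp_mx2, add_mx2, scale_mx2).
have eN : sl_e F \in N -> (sl2 F <= N)%VS.
  move=> eN.
  have hN: sl_h F \in N.
    apply: (memN (-1)) (adN _ _ fs eN); first by rewrite oppr_eq0 oner_neq0.
    by rewrite /lie_br !brE; congr mx2; ring.
  have fN: sl_f F \in N.
    apply: (memN 2%:R) (adN _ _ fs hN) => //.
    by rewrite /lie_br !brE; congr mx2; ring.
  by apply/span_subvP => X; rewrite !inE => /or3P[] /eqP->.
have hN : sl_h F \in N -> (sl2 F <= N)%VS.
  move=> hN; apply: eN; apply: (memN (- 2%:R)) (adN _ _ ees hN).
    by rewrite oppr_eq0.
  by rewrite /lie_br !brE; congr mx2; ring.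
have [c0|c_neq0] := eqVneq c 0; last first.
  apply: eN; apply: (memN (- 2%:R * c)) (adN _ _ ees (adN _ _ ees PN)).
    by rewrite mulf_neq0 ?oppr_eq0.
  by rewrite /lie_br !brE; congr mx2; ring.
have [b0|b_neq0] := eqVneq b 0; last first.
  have fN : sl_f F \in N.
    apply: (memN (- 2%:R * b)) (adN _ _ fs (adN _ _ fs PN)).
      by rewrite mulf_neq0 ?oppr_eq0.
    by rewrite /lie_br !brE; congr mx2; ring.
  apply: hN; apply: (memN 1) (adN _ _ ees fN); first exact: oner_neq0.
  by rewrite /lie_br !brE; congr mx2; ring.
apply: hN; apply: (memN a) PN; last first.
  by rewrite b0 c0 brE; congr mx2; ring.
by apply: contraNneq Pn0 => a0; rewrite a0 b0 c0 oppr0 mx2_0.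
Qed.

(** The derived algebra is stable under sl(2) and contains [h, e] = 2e, which is nonzero, so
    simplicity makes it everything. *)
Lemma lie_brv_sl2 : lie_brv (sl2 F) (sl2 F) = sl2 F.
Proof.
apply/eqP; rewrite eqEsubv; apply/andP; split.
  by apply: lie_brv_subP => X Y _ _; apply: lie_br_sl2.
have hs : sl_h F \in sl2 F by rewrite mem_sl2 mxtrace_mx2 subrr.
have ees : sl_e F \in sl2 F by rewrite mem_sl2 mxtrace_mx2 addr0.
apply: (@sl2_simple _ (lie_br (sl_h F) (sl_e F))); rewrite ?lie_br_sl2 ?mem_lie_brv //.
  move=> X Y Xs Ys; apply: mem_lie_brv => //.
  by apply: subvP Ys; apply: lie_brv_subP => ? ? _ _; apply: lie_br_sl2.
rewrite /lie_br !(mul_mx2, opp_mx2, add_mx2) -mx2_0.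
apply/eqP => /eq_mx2[_ /eqP + _ _].
by rewrite !(mulr0, mul0r, mulr1, mulrN1, opprK, addr0, add0r) (negPf two_neq0).
Qed.

(* The columns of the conjugating matrix are eigenvectors for the two opposite
   eigenvalues when [\det P != 0], and a Jordan basis otherwise. *)
Lemma sl2_conj P (l : F) : l ^+ 2 = - \det P -> P \in sl2 F -> P != 0 ->
  exists2 B, \det B = 1 & exists2 k, k != 0 &
    P *m B = B *m (k *: if \det P == 0 then sl_e F else sl_h F).
Proof.
move=> l2 /sl2P[a [b [c EP]]] Pn0; rewrite {}EP in l2 Pn0 *.
rewrite det_mx2 in l2 *.
have {}l2 : l ^+ 2 = a ^+ 2 + b * c by rewrite l2; ring.
have -> : (a * - a - b * c == 0) = (l == 0).
  by rewrite -(sqrf_eq0 l) l2 -oppr_eq0; congr (_ == _); ring.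
(* The eigenvectors (a + l, c) and (a - l, c) can degenerate when c = 0, so the triangular case is
   separate. *)
have [c0|c_neq0] := eqVneq c 0.
  rewrite {}c0 in l2 Pn0 *.
  have a2 : (l == 0) = (a == 0) by rewrite -sqrf_eq0 l2 mulr0 addr0 sqrf_eq0.
  have [l0|l_neq0] := eqVneq l 0.
    have a0 : a = 0 by apply/eqP; rewrite -a2 l0.
    rewrite {}a0 oppr0 in Pn0 *; exists 1%:M; first exact: det1.
    exists b; first by apply: contraNneq Pn0 => ->; rewrite mx2_0.
    by rewrite mulmx1 mul1mx scale_mx2; congr mx2; ring.
  have a_neq0 : a != 0 by rewrite -a2.
  exists (mx2 1 (- b / (2%:R * a)) 0 1); first by rewrite det_mx2; ring.
  exists a => //; rewrite scale_mx2 !mul_mx2.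
  by congr mx2; first [ring | field; apply/andP].
have [l0|l_neq0] := eqVneq l 0.
  have {}l2 : a ^+ 2 = - (b * c) by apply/eqP; rewrite -addr_eq0 -l2 l0 expr0n.
  (* The first column (a, c) spans the kernel, and [P] sends the second column to -1/c times the
     first. *)
  exists (mx2 a (- c^-1) c 0); first by rewrite det_mx2; field.
  exists (- c^-1); first by rewrite oppr_eq0 invr_eq0.
  rewrite scale_mx2 !mul_mx2.
  congr mx2; try by field.
  by rewrite -expr2 l2; ring.
(* The columns are (a + l, c) and (a - l, c), for the eigenvalues l and -l; the first is divided by
   2lc to bring the determinant to 1. *)
exists (mx2 ((a + l) / (2%:R * l * c)) (a - l) (2%:R * l)^-1 c).
  by rewrite det_mx2; field; rewrite l_neq0 c_neq0 two_neq0.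
exists l => //; rewrite scale_mx2 !mul_mx2.
have bE : b = (l ^+ 2 - a ^+ 2) / c by rewrite l2 addrAC subrr add0r mulfK.
rewrite bE; congr mx2; by field; rewrite ?l_neq0 ?c_neq0 ?two_neq0.
Qed.

End Sl2.

(** * Block diagonal matrices and projections to the two factors *)

Section Blocks.
Variable F : fieldType.
Implicit Types (b : bool) (P Q : 'M[F]_2) (X Y : 'M[F]_(2 + 2)).
Implicit Types (L S U : {vspace 'M[F]_(2 + 2)}).

(* Both factors are treated at once: [blk b P Q] has [P] in the first block
   when [b] is true, and in the second one otherwise. *)
Definition blk b P Q : 'M[F]_(2 + 2) :=
  if b then block_mx P 0 0 Q else block_mx Q 0 0 P.
Definition prj b X : 'M[F]_2 := if b then ulsubmx X else drsubmx X.

Lemma prj_blk b P Q : prj b (blk b P Q) = P.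
Proof. by case: b; rewrite /prj /blk ?block_mxKul ?block_mxKdr. Qed.

Lemma blkN b P Q : blk (~~ b) P Q = blk b Q P.
Proof. by case: b. Qed.

Lemma prjN_blk b P Q : prj (~~ b) (blk b P Q) = Q.
Proof. by rewrite -blkN prj_blk. Qed.

Lemma blk_inj b P Q P' Q' : blk b P Q = blk b P' Q' -> P = P' /\ Q = Q'.
Proof.
move=> E; have := congr1 (prj (~~ b)) E; have := congr1 (prj b) E.
by rewrite !prj_blk !prjN_blk.
Qed.

Lemma mul_blk b P Q P' Q' : blk b P Q *m blk b P' Q' = blk b (P *m P') (Q *m Q').
Proof.
by case: b; rewrite mulmx_block !(mulmx0, mul0mx, addr0, add0r).
Qed.

Lemma blk_linear b k P Q P' Q' :
  k *: blk b P Q + blk b P' Q' = blk b (k *: P + P') (k *: Q + Q').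
Proof.
case: b; rewrite /blk scale_block_mx add_block_mx !scaler0 !addr0 //.
Qed.

Lemma blk0 b : blk b 0 0 = 0.
Proof. by case: b; rewrite /blk block_mx0. Qed.

Lemma blk1 b : blk b 1%:M 1%:M = 1%:M.
Proof. by case: b; rewrite /blk -scalar_mx_block. Qed.

Lemma add_blk b P Q P' Q' : blk b P Q + blk b P' Q' = blk b (P + P') (Q + Q').
Proof. by rewrite -[blk b P Q]scale1r blk_linear !scale1r. Qed.

Lemma scale_blk b k P Q : k *: blk b P Q = blk b (k *: P) (k *: Q).
Proof. by rewrite -[LHS]addr0 -(blk0 b) blk_linear !addr0. Qed.

Lemma opp_blk b P Q : - blk b P Q = blk b (- P) (- Q).
Proof. by rewrite -!scaleN1r scale_blk. Qed.

Lemma lie_br_blk b P Q P' Q' :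
  lie_br (blk b P Q) (blk b P' Q') = blk b (lie_br P P') (lie_br Q Q').
Proof. by rewrite /lie_br !mul_blk opp_blk add_blk. Qed.

Lemma so4P b X :
  reflect (exists P Q, [/\ P \in sl2 F, Q \in sl2 F & X = blk b P Q]) (X \in @so4 F).
Proof.
apply: (iffP and4P) => [[/eqP ur0 /eqP dl0 tul tdr]|].
  exists (prj b X), (prj (~~ b) X); rewrite !mem_sl2.
  by split; [case: b | case: b | case: b; rewrite /blk /prj /= -{1}[X]submxK ur0 dl0].
case=> P [Q [Ps Qs ->]]; rewrite !mem_sl2 in Ps Qs.
by case: b; rewrite /blk block_mxKul block_mxKur block_mxKdl block_mxKdr eqxx Ps Qs.
Qed.

Definition emb_fun b P := blk b P 0.

Lemma emb_is_linear b : linear (emb_fun b).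
Proof. by move=> k P Q; rewrite /emb_fun blk_linear scaler0 addr0. Qed.
HB.instance Definition _ b :=
  GRing.isLinear.Build F 'M[F]_2 'M[F]_(2 + 2) _ (emb_fun b) (emb_is_linear b).

Lemma prj_is_linear b : linear (prj b).
Proof. by move=> k X Y; case: b; apply/matrixP => i j; rewrite !mxE. Qed.
HB.instance Definition _ b :=
  GRing.isLinear.Build F 'M[F]_(2 + 2) 'M[F]_2 _ (prj b) (prj_is_linear b).

Definition emb b : 'Hom('M[F]_2, 'M[F]_(2 + 2)) := linfun (emb_fun b).
Definition prjl b : 'Hom('M[F]_(2 + 2), 'M[F]_2) := linfun (prj b).

Lemma embE b P : emb b P = blk b P 0.
Proof. by rewrite lfunE. Qed.

Lemma prjlE b X : prjl b X = prj b X.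
Proof. by rewrite lfunE. Qed.

Lemma lker_emb b : lker (emb b) = 0%VS.
Proof. by apply/eqP/lker0P => P Q; rewrite !embE => /blk_inj[]. Qed.

Lemma so4_prjl b L : {subset L <= @so4 F} -> (prjl b @: L <= sl2 F)%VS.
Proof.
move=> Lso; apply/subvP => _ /memv_imgP[X /Lso/(so4P b)[P [Q [Ps _ ->]]] ->].
by rewrite prjlE prj_blk.
Qed.

(** In each block the brackets fill at most a line, so the derived space lies in the span of one
    vector per block. That span is abelian, hence the second derived space vanishes. *)
Lemma small_projections_solvable S : {subset S <= @so4 F} ->
  (forall b, \dim (prjl b @: S) <= 2)%N -> lie_solvable S.
Proof.
move=> Sso dimS; have [Z1 Z1P] := dim2_lie_brv_sub_line (dimS true).
have [Z2 Z2P] := dim2_lie_brv_sub_line (dimS false).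
have brS : (lie_brv S S <= <[blk true Z1 0]> + <[blk true 0 Z2]>)%VS.
  apply: lie_brv_subP => X Y XS YS.
  have [P [Q [_ _ EX]]] := so4P true _ (Sso _ XS).
  have [P' [Q' [_ _ EY]]] := so4P true _ (Sso _ YS).
  have := Z2P _ _ (memv_img (prjl false) XS) (memv_img (prjl false) YS).
  have := Z1P _ _ (memv_img (prjl true) XS) (memv_img (prjl true) YS).
  rewrite !prjlE EX EY lie_br_blk !prj_blk.
  move=> /vlineP[k ->] /vlineP[k' ->].
  apply/memv_addP; exists (k *: blk true Z1 0); first by rewrite memvZ // memv_line.
  exists (k' *: blk true 0 Z2); first by rewrite memvZ // memv_line.
  by rewrite !scale_blk !scaler0 add_blk addr0 add0r.
exists 2%N; apply/eqP; rewrite -subv0; apply: lie_brv_subP => X Y.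
move=> /(subvP brS)/memv_addP[_ /vlineP[k1 ->] [_ /vlineP[k2 ->] ->]].
move=> /(subvP brS)/memv_addP[_ /vlineP[k3 ->] [_ /vlineP[k4 ->] ->]].
rewrite !scale_blk !scaler0 !add_blk !addr0 !add0r lie_br_blk.
by rewrite !(lie_brZl, lie_brZr) !lie_brxx !scaler0 blk0 mem0v.
Qed.

(** Otherwise both projections of [L], hence those of its semisimple part [S], have dimension at
    most 2. Then [S] is a solvable ideal of itself and must be zero. *)
Lemma levi_prjl_sl2 L : {subset L <= @so4 F} -> levi_decomposable L ->
  exists b, (prjl b @: L)%VS = sl2 F.
Proof.
move=> Lso [_ [S [I [[subS _ LE _] [_ ssS] _ Sn0 _]]]].
have SL : (S <= L)%VS by rewrite -LE addvSl.
case: (altP (prjl true @: L =P sl2 F)%VS) => [|nt]; first by exists true.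
case: (altP (prjl false @: L =P sl2 F)%VS) => [|nf]; first by exists false.
case: Sn0; apply: ssS; first by split; rewrite ?subvv.
apply: small_projections_solvable => [X /(subvP SL)/Lso //|b].
apply: leq_trans (dimvS (limgS _ SL)) _.
have ne : (prjl b @: L)%VS != sl2 F by case: b.
move: ne; rewrite eqEdim so4_prjl // dim_sl2 -ltnNge.
by rewrite ltnS.
Qed.

(** * One full factor plus a line in the other *)

Section Standard.
Hypothesis two_neq0 : 2%:R != 0 :> F.

Definition sl2_blk b : {vspace 'M[F]_(2 + 2)} := (emb b @: sl2 F)%VS.

Lemma sl2_blkP b X : reflect (exists2 P, P \in sl2 F & X = blk b P 0) (X \in sl2_blk b).
Proof.
by apply: (iffP memv_imgP) => -[P Ps ->]; exists P; rewrite ?embE.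
Qed.

Lemma dim_sl2_blk b : \dim (sl2_blk b) = 3%N.
Proof. by rewrite limg_dim_eq ?dim_sl2 // lker_emb capv0. Qed.

(** An element of sl(2) lifts to [L], and the other block of the lift is irrelevant when bracketing
    with [blk b Y 0]. Hence the preimage of [U] under [emb b] is stable under sl(2), and simplicity
    applies. This serves both for ideals of a factor and for [U] equal to [L]. *)
Lemma sl2_blk_sub b L U P : (sl2 F <= prjl b @: L)%VS ->
    {subset L <= @so4 F} -> (forall X Y, X \in L -> Y \in U -> lie_br X Y \in U) ->
  P \in sl2 F -> P != 0 -> blk b P 0 \in U -> (sl2_blk b <= U)%VS.
Proof.
move=> sl2L Lso adU Ps Pn0 PU.
suff/subvP sU : (sl2 F <= emb b @^-1: U)%VS.
  by apply/subvP => _ /sl2_blkP[Q /sU Qs ->]; rewrite -embE memv_preim.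
apply: (sl2_simple two_neq0) Ps _ Pn0; last by rewrite -memv_preim embE.
move=> X Y /(subvP sl2L)/memv_imgP[X' X'L ->]; rewrite -!memv_preim !embE => YU.
have [Q [Q' [_ _ EX]]] := so4P b _ (Lso _ X'L).
by have := adU _ _ X'L YU; rewrite prjlE EX prj_blk lie_br_blk lie_br0.
Qed.

Lemma sl2_blk_so4 b : {subset sl2_blk b <= @so4 F}.
Proof. by move=> _ /sl2_blkP[P Ps ->]; apply/(so4P b); exists P, 0; rewrite mem0v. Qed.

Lemma sl2_blk_subalgebra b : lie_subalgebra (sl2_blk b).
Proof.
move=> _ _ /sl2_blkP[P _ ->] /sl2_blkP[Q _ ->].
by apply/sl2_blkP; exists (lie_br P Q); rewrite ?lie_br_sl2 // lie_br_blk lie_br0.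
Qed.

Lemma lie_brv_sl2_blk b : lie_brv (sl2_blk b) (sl2_blk b) = sl2_blk b.
Proof.
apply/eqP; rewrite eqEsubv; apply/andP; split.
  by apply: lie_brv_subP; apply: sl2_blk_subalgebra.
rewrite [X in (X <= _)%VS]/sl2_blk -(lie_brv_sl2 two_neq0) limg_span.
apply/span_subvP => _ /mapP[_ /allpairsP[u [/vbasis_mem u1 /vbasis_mem u2 ->]] ->].
(* The zero block is read as [0, 0], so that the embedded bracket becomes a bracket of embedded
   elements. *)
rewrite embE -(lie_br0 0) -lie_br_blk.
by apply: mem_lie_brv; apply/sl2_blkP; [exists u.1 | exists u.2].
Qed.

(** A nonzero ideal is the whole factor, which is perfect; its derived series stays in dimension 3
    and never reaches 0. *)
Lemma sl2_blk_semisimple b : lie_semisimple (sl2_blk b).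
Proof.
split=> [|I [IS adI] [k solI]]; first exact: sl2_blk_subalgebra.
apply/eqP/negPn/negP => In0.
have /sl2_blkP[P Ps EP] := subvP IS _ (memv_pick I).
have Pn0 : P != 0.
  by apply: contraNneq In0 => P0; rewrite -vpick0 EP P0 blk0.
have sl2S : (sl2 F <= prjl b @: sl2_blk b)%VS.
  apply/subvP => Q Qs; apply/memv_imgP; exists (blk b Q 0).
    by apply/sl2_blkP; exists Q.
  by rewrite prjlE prj_blk.
have SI : (sl2_blk b <= I)%VS.
  by apply: (sl2_blk_sub sl2S _ adI Ps Pn0); [exact: sl2_blk_so4 | rewrite -EP memv_pick].
have IE : I = sl2_blk b by apply/eqP; rewrite eqEsubv IS.
have : \dim (lie_derived_series I k) = 3%N.
  rewrite IE -(dim_sl2_blk b); congr (\dim _).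
  by elim: k {solI} => //= k ->; apply: lie_brv_sl2_blk.
by rewrite solI dimv0.
Qed.

(** The common shape of the four algebras, before [Q] is conjugated to a multiple of h or e. *)
Definition std b Q : {vspace 'M[F]_(2 + 2)} := (sl2_blk b + <[blk b 0 Q]>)%VS.

Lemma stdP b Q X :
  reflect (exists2 P, P \in sl2 F & exists k, X = blk b P (k *: Q)) (X \in std b Q).
Proof.
apply: (iffP memv_addP) => [[_ /sl2_blkP[P Ps ->] [_ /vlineP[k ->] ->]]|[P Ps [k ->]]].
  by exists P => //; exists k; rewrite scale_blk scaler0 add_blk addr0 add0r.
exists (blk b P 0); first by apply/sl2_blkP; exists P.
exists (k *: blk b 0 Q); first by rewrite memvZ // memv_line.
by rewrite scale_blk scaler0 add_blk addr0 add0r.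
Qed.

Lemma sl2_blk_cap_line b Q : (sl2_blk b :&: <[blk b 0 Q]>)%VS = 0%VS.
Proof.
apply/eqP; rewrite -subv0; apply/subvP => X /memv_capP[/sl2_blkP[P _ ->] /vlineP[k]].
by rewrite scale_blk scaler0 => /blk_inj[-> _]; rewrite blk0 mem0v.
Qed.

Lemma std_direct_sum b Q :
  lie_direct_sum (std b Q) (sl2_blk b) <[blk b 0 Q]>.
Proof.
split; rewrite ?sl2_blk_cap_line //; split; rewrite ?addvSl ?addvSr //.
  move=> _ _ /stdP[P Ps [k ->]] /sl2_blkP[P' P's ->].
  by apply/sl2_blkP; exists (lie_br P P'); rewrite ?lie_br_sl2 // lie_br_blk lie_br0.
move=> _ _ /stdP[P Ps [k ->]] /vlineP[k' ->].
rewrite lie_brZr lie_br_blk lie_br0 lie_brZl lie_brxx scaler0 blk0 scaler0.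
exact: mem0v.
Qed.

Lemma blk0_neq0 b Q : Q != 0 -> blk b 0 Q != 0.
Proof. by apply: contra_neq => Q0; move: Q0; rewrite -(blk0 b) => /blk_inj[]. Qed.

Lemma dim_std b Q : Q != 0 -> \dim (std b Q) = 4%N.
Proof.
move=> Qn0; rewrite /std dimv_disjoint_sum ?sl2_blk_cap_line // dim_sl2_blk dim_vline.
by rewrite blk0_neq0.
Qed.

Lemma std_levi b Q : Q \in sl2 F -> Q != 0 -> levi_decomposable_so4 4 (std b Q).
Proof.
move=> Qs Qn0; have [idS idJ sumE capE] := std_direct_sum b Q.
have subL : lie_subalgebra (std b Q).
  move=> _ _ /stdP[P Ps [k ->]] /stdP[P' P's [k' ->]]; apply/stdP.
  exists (lie_br P P'); first exact: lie_br_sl2.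
  (* The coefficient on [Q] is 0 because the line is abelian. *)
  by exists 0; rewrite lie_br_blk lie_brZl lie_brZr lie_brxx !scaler0 scale0r.
split; last exact: dim_std.
  split=> // _ /stdP[P Ps [k ->]]; apply/(so4P b).
  by exists P, (k *: Q); rewrite memvZ.
split=> //; exists (sl2_blk b), <[blk b 0 Q]>%VS; split.
- by split=> //; apply: sl2_blk_subalgebra.
- exact: sl2_blk_semisimple.
- exact: lie_solvable_line.
- by apply/eqP; rewrite -dimv_eq0 dim_sl2_blk.
- by apply/eqP; rewrite -dimv_eq0 dim_vline blk0_neq0.
Qed.

(** Each projection has rank at most 3 on the 4-dimensional [L], so its kernel gives a nonzero
    element of [L] supported in the opposite block. In the block onto which [L] surjects, this
    element generates the whole factor; the element of the other block supplies the line, and 3 + 1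
    = 4 leaves no room for more. *)
Lemma levi_dim4_std L : levi_decomposable_so4 4 L ->
  exists b, exists2 Q, Q \in sl2 F & Q != 0 /\ L = std b Q.
Proof.
case=> -[Lso subL] leviL dimL; have [b prL] := levi_prjl_sl2 Lso leviL.
have pick_ker b' : (\dim (prjl b' @: L) <= 3)%N ->
    exists2 Q, Q \in sl2 F & Q != 0 /\ blk b' 0 Q \in L.
  move=> dimb'; set K := (L :&: lker (prjl b'))%VS.
  have Kn0 : K != 0%VS.
    apply: contraTneq dimb' => K0; rewrite -ltnNge.
    by have := limg_ker_dim (prjl b') L; rewrite -/K K0 dimv0 add0n => ->; rewrite dimL.
  have /memv_capP[XL] := memv_pick K.
  have [P [Q [_ Qs EX]]] := so4P b' _ (Lso _ XL).
  rewrite memv_ker prjlE EX prj_blk => /eqP P0; rewrite P0 in EX.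
  exists Q => //; split; last by rewrite -EX.
  by apply: contraNneq Kn0 => Q0; rewrite -vpick0 EX Q0 blk0.
have dim_le b' : (\dim (prjl b' @: L) <= 3)%N by rewrite -(dim_sl2 F) dimvS // so4_prjl.
(* Projecting to the factor other than [b] yields a kernel element inside factor [b]. *)
have [P Ps [Pn0]] := pick_ker _ (dim_le (~~ b)); rewrite blkN => PL.
have [Q Qs [Qn0 QL]] := pick_ker _ (dim_le b).
exists b, Q => //; split=> //; apply/esym/eqP.
rewrite eqEdim dim_std // dimL leqnn andbT subv_add -memvE QL andbT.
by apply: (sl2_blk_sub _ Lso subL Ps Pn0 PL); rewrite prL.
Qed.

End Standard.

(** * Inner automorphisms and an invariant of subalgebras *)

Lemma SL2xSL2P b A :
  SL2xSL2 A <-> exists P Q, [/\ \det P = 1, \det Q = 1 & A = blk b P Q].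
Proof.
by split=> -[P [Q [dP dQ ->]]]; case: b; do [by exists P, Q | by exists Q, P].
Qed.

Lemma det1_unitmx P : \det P = 1 -> P \in unitmx.
Proof. by rewrite unitmxE => ->; rewrite unitr1. Qed.

Lemma invmx_blk b P Q : \det P = 1 -> \det Q = 1 ->
  blk b P Q \in unitmx /\ invmx (blk b P Q) = blk b (invmx P) (invmx Q).
Proof.
move=> /det1_unitmx uP /det1_unitmx uQ.
have [uA _] := mulmx1_unit (etrans (mul_blk b P Q (invmx P) (invmx Q))
  (etrans (congr2 (blk b) (mulmxV uP) (mulmxV uQ)) (blk1 b))).
split=> //; rewrite -[RHS]mul1mx -(mulVmx uA) -mulmxA mul_blk !mulmxV //.
by rewrite blk1 mulmx1.
Qed.

Lemma conj_by_blk b A B P Q : \det A = 1 -> \det B = 1 ->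
  conj_by (blk b A B) (blk b P Q) = blk b (A *m P *m invmx A) (B *m Q *m invmx B).
Proof. by move=> dA dB; rewrite conj_byE (invmx_blk b dA dB).2 !mul_blk. Qed.

Lemma inner_equiv_sym L S : inner_equiv L S -> inner_equiv S L.
Proof.
case=> A /(SL2xSL2P true)[P [Q [dP dQ ->]]] <-.
exists (blk true (invmx P) (invmx Q)).
  by apply/(SL2xSL2P true); exists (invmx P), (invmx Q); rewrite !det_inv dP dQ invr1.
rewrite -limg_comp -[RHS]lim1g; apply: eq_in_limg => X _.
have [uA <-] := invmx_blk true dP dQ.
by rewrite comp_lfunE id_lfunE !conj_byE invmxK !mulmxA mulVmx // mul1mx mulmxKV.
Qed.

(** Conjugation by the identity on block [b] and the inverse of [B] on the other fixes the full
    factor pointwise and sends [Q] to [k *: Q'], which spans the same line as [Q']. *)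
Lemma inner_equiv_std b Q Q' B k : \det B = 1 -> k != 0 ->
  Q *m B = B *m (k *: Q') -> inner_equiv (std b Q) (std b Q').
Proof.
move=> dB kn0 QB; have uB := det1_unitmx dB.
have dB' : \det (invmx B) = 1 by rewrite det_inv dB invr1.
exists (blk b 1%:M (invmx B)).
  by apply/(SL2xSL2P b); exists 1%:M, (invmx B); rewrite det1.
rewrite /std limgD limg_line conj_by_blk ?det1 // invmxK -(mulmxA _ Q) QB mulKmx //.
rewrite mulmx0 mul0mx; congr (_ + _)%VS.
  rewrite -[RHS]lim1g; apply: eq_in_limg => _ /sl2_blkP[P _ ->].
  by rewrite id_lfunE conj_by_blk ?det1 // invmx1 mul1mx mulmx1 mulmx0 mul0mx.
have -> : blk b 0 (k *: Q') = k *: blk b 0 Q' by rewrite scale_blk scaler0.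
apply/eqP; rewrite eqEsubv -!memvE.
rewrite memvZ ?memv_line //=; apply/vlineP; exists k^-1.
by rewrite scalerA mulVf // scale1r.
Qed.

(* Detects the pairs [(b, k)] such that [L] meets the factor [b] in a nonzero
   element that is nilpotent (when [k] is true) or semisimple (otherwise). *)
Definition meets b (k : bool) L : Prop :=
  exists P, [/\ blk b P 0 \in L, P != 0 & (\det P == 0) = k].

(** A nonzero traceless two-by-two matrix is nilpotent exactly when its determinant vanishes, and
    conjugation within a block preserves the determinant. *)
Lemma meets_inner_equiv b k L S : inner_equiv L S -> meets b k L -> meets b k S.
Proof.
case=> A /(SL2xSL2P b)[B [C [dB dC ->]]] <- [P [PL Pn0 <-]].
have uB := det1_unitmx dB.
exists (B *m P *m invmx B); split.
- rewrite -(mul0mx _ (invmx C)) -(mulmx0 _ C) -conj_by_blk //.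
  exact: memv_img.
- apply: contra_neq Pn0 => E.
  have -> : P = invmx B *m (B *m P *m invmx B) *m B.
    by rewrite !mulmxA mulVmx // mul1mx mulmxKV.
  by rewrite E mulmx0 mul0mx.
- by rewrite !det_mulmx det_inv dB invr1 mulr1 mul1r.
Qed.

End Blocks.

(** * The four algebras: identification, exhaustiveness, inequivalence *)

Section A1JSubalgebras.
Variable F : numClosedFieldType.
Implicit Types (b k : bool) (i : 'I_4) (L : {vspace 'M[F]_(2 + 2)}).

Let two_neq0 : 2%:R != 0 :> F.
Proof. by rewrite pnatr_eq0. Qed.

Lemma chevalleyE b :
  (if b then (x1 F, y1 F, h1 F) else (x2 F, y2 F, h2 F)) =
  (blk b (sl_e F) 0, blk b (sl_f F) 0, blk b (sl_h F) 0).
Proof.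
have ord2 (i : 'I_2) : i = 0 \/ i = 1.
  by case: i => [[|[|//]] lti]; [left | right]; apply: val_inj.
(* [E] counts from 1 while ordinals count from 0, whence the successor; the second block starts
   after two rows, whence the offset 2. *)
have EE p q (r s : 'I_2) :
    (p = (if b then r : nat else 2 + r).+1)%N -> (q = (if b then s : nat else 2 + s).+1)%N ->
    E F p q = blk b (delta_mx r s) 0.
  move=> -> ->; rewrite /E /blk; apply/matrixP => i j.
  have [i' ->|i' ->] := split_ordP i; have [j' ->|j' ->] := split_ordP j; case: b;
  rewrite ?block_mxEul ?block_mxEur ?block_mxEdl ?block_mxEdr !mxE -!val_eqE /=;
  case: (ord2 r) => ->; case: (ord2 s) => ->; rewrite !inordK //=;
  by do ?[case: (ord2 i') => ->]; do ?[case: (ord2 j') => ->].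
have dE (i j : 'I_2) : delta_mx i j = mx2 ((i == 0) && (j == 0))%:R
    ((i == 0) && (j == 1))%:R ((i == 1) && (j == 0))%:R ((i == 1) && (j == 1))%:R :> 'M[F]_2.
  by apply: mx2P; rewrite !mxE; case: (ord2 i) => ->; case: (ord2 j) => ->.
have eE : blk b (sl_e F) 0 = blk b (delta_mx 0 1) 0 by rewrite dE.
have fE : blk b (sl_f F) 0 = blk b (delta_mx 1 0) 0 by rewrite dE.
have hE : blk b (sl_h F) 0 = blk b (delta_mx 0 0) 0 - blk b (delta_mx 1 1) 0.
  rewrite opp_blk add_blk subr0 !dE /= opp_mx2 add_mx2.
  by congr (blk b _ 0); congr mx2; ring.
rewrite eE fE hE; case: b EE {eE fE hE} => EE.
  by congr (_, _, _ - _); apply: EE.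
by congr (_, _, _ - _); apply: EE.
Qed.

Definition sl_gen k : 'M[F]_2 := if k then sl_e F else sl_h F.

Lemma sl_gen_sl2 k : sl_gen k \in sl2 F.
Proof. by case: k; rewrite mem_sl2 mxtrace_mx2 ?addr0 ?subrr. Qed.

Lemma det_sl_gen k : (\det (sl_gen k) == 0) = k.
Proof.
case: k; rewrite det_mx2 ?mulr0 ?mul0r ?mulr1 ?mul1r subr0 ?eqxx //.
by rewrite oppr_eq0 oner_eq0.
Qed.

Lemma sl_gen_neq0 k : sl_gen k != 0.
Proof.
apply/eqP; rewrite -mx2_0.
by case: k => /eq_mx2[/eqP + /eqP]; rewrite oner_eq0.
Qed.

(* [A1J F i] is the full factor [i < 2] plus a line in the other factor,
   spanned by a nilpotent element for odd [i] and a semisimple one for even [i]. *)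
Lemma A1J_stdE i :
  [/\ A1 F i = sl2_blk F (i < 2)%N,
      J F i = <[blk (i < 2)%N 0 (sl_gen (odd i))]>%VS &
      A1J F i = std (i < 2)%N (sl_gen (odd i))].
Proof.
suff [E1 E2] : A1 F i = sl2_blk F (i < 2)%N /\
    J F i = <[blk (i < 2)%N 0 (sl_gen (odd i))]>%VS by rewrite /A1J E1 E2.
have [ex1 ey1 eh1] := chevalleyE true; have [ex2 ey2 eh2] := chevalleyE false.
(* Swapping the blocks puts the generator of the line in the form given by [chevalleyE] for the
   other factor. *)
rewrite -blkN /sl2_blk limg_span /=.
case: i => [[|[|[|[|//]]]] lti];
  by rewrite /A1 /J !(tnth_nth (0, 0)%VS) /= !embE ?ex1 ?ey1 ?eh1 ?ex2 ?ey2 ?eh2.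
Qed.

(** The full factor contains nonzero elements of both kinds, whereas the other factor is met only in
    a line, whose nonzero elements are all of the kind of its generator. *)
Lemma meets_A1J b k i :
  meets b k (A1J F i) <-> ((i < 2)%N == b) || (odd i == k).
Proof.
have [_ _ ->] := A1J_stdE i; set b' := (i < 2)%N; split.
  case=> P [PL Pn0 <-]; have [//|nb] := eqVneq b' b.
  have {nb} Eb : b = ~~ b' by case: b b' nb {PL} => [] [].
  move: PL; rewrite Eb blkN => /stdP[_ _ [c /blk_inj[_ EP]]].
  rewrite EP detZ mulf_eq0 expf_eq0 /= det_sl_gen.
  suff /negPf-> : c != 0 by [].
  by apply: contraNneq Pn0 => c0; rewrite EP c0 scale0r.
have [<- _|nb /= /eqP<-] := eqVneq b' b.
  exists (sl_gen k); rewrite sl_gen_neq0 det_sl_gen; split=> //; apply/stdP.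
  by exists (sl_gen k); rewrite ?sl_gen_sl2 //; exists 0; rewrite scale0r.
have {nb} -> : b = ~~ b' by case: b b' nb => [] [].
exists (sl_gen (odd i)); rewrite sl_gen_neq0 det_sl_gen blkN; split=> //.
by apply/stdP; exists 0; rewrite ?mem0v //; exists 1; rewrite scale1r.
Qed.

Lemma A1J_levi i : levi_decomposable_so4 4 (A1J F i) /\
  lie_direct_sum (A1J F i) (A1 F i) (J F i).
Proof.
have [-> -> ->] := A1J_stdE i; split; last exact: std_direct_sum.
by apply: std_levi; rewrite ?sl_gen_sl2 ?sl_gen_neq0.
Qed.

Lemma levi_A1J L : levi_decomposable_so4 4 L -> exists i, inner_equiv L (A1J F i).
Proof.
case/(levi_dim4_std two_neq0) => b [Q Qs [Qn0 ->]].
(* Algebraic closedness enters here: the eigenvalue of [Q] is a square root of [- \det Q]. *)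
have [B dB [c cn0 QB]] := sl2_conj two_neq0 (sqrtCK (- \det Q)) Qs Qn0.
have [i [Eb Ek]] : exists i : 'I_4, (i < 2)%N = b /\ odd i = (\det Q == 0).
  case: b; case: (\det Q == 0).
  - by exists (inord 1%N); split; rewrite inordK.
  - by exists (inord 0%N); split; rewrite inordK.
  - by exists (inord 3%N); split; rewrite inordK.
  - by exists (inord 2%N); split; rewrite inordK.
exists i; have [_ _ ->] := A1J_stdE i; rewrite Eb Ek.
exact: inner_equiv_std QB.
Qed.

Lemma A1J_inj L i j : inner_equiv L (A1J F i) -> inner_equiv L (A1J F j) -> i = j.
Proof.
move=> Li Lj; have ij b k : meets b k (A1J F j) -> meets b k (A1J F i).
  by move/(meets_inner_equiv (inner_equiv_sym Lj))/(meets_inner_equiv Li).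
(* One test suffices: the pair made of the factor not full in [A1J F i] and the kind opposite to its
   line is missed by [A1J F i]. If [A1J F j] misses it too, then [j] has the same full factor and
   the same parity as [i]. *)
have : ~~ (((j < 2)%N == ~~ (i < 2)%N) || (odd j == ~~ odd i)).
  apply/negP => /meets_A1J/ij/meets_A1J.
  by case: (i < 2)%N; case: (odd i).
case: i j {Li Lj ij} => [[|[|[|[|//]]]] lti] [[|[|[|[|//]]]] ltj] //= _;
  exact: val_inj.
Qed.

End A1JSubalgebras.

Theorem theorem7p2 (R : realType) :
  (forall i : 'I_4,
     levi_decomposable_so4 4 (A1J (complex R) i) /\
     lie_direct_sum (A1J (complex R) i) (A1 (complex R) i) (J (complex R) i)) /\
  (forall L : {vspace 'M[complex R]_(2 + 2)},
     levi_decomposable_so4 4 L ->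
     exists! i : 'I_4, inner_equiv L (A1J (complex R) i)).
Proof.
split=> [i|L /levi_A1J[i Li]]; first exact: A1J_levi.
by exists i; split=> // j /(A1J_inj Li).
Qed.
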